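(* The map $\beta$ (defined in the context) is a bijection between the set $\mathcal{M}^{lab}_n$ of labeled Motzkin paths of length $n$ and the set $\mathcal{R}_{n+1}(12323)$ of restricted growth functions of length $n+1$ avoiding $12323$.
   Context: A restricted growth function (RGF) of length $n$ is a sequence of positive integers $r_1\cdots r_n$ with $r_1=1$ and $r_i\le 1+\max\{r_1,\dots,r_{i-1}\}$ for $i\ge2$. The standardization $\mathrm{std}(Q)$ of an integer sequence replaces all occurrences of its $i$-th smallest distinct value by $i$, for all $i$. An RGF $R$ contains $Q$ if some subsequence of $R$ has standardization equal to $Q$; otherwise it avoids $Q$. $\mathcal{R}_n(Q)$ is the set of RGFs of length $n$ avoiding $Q$. A Motzkin path of length $n$ is a lattice path from $(0,0)$ to $(n,0)$ with steps $U=(1,1)$, $D=(1,-1)$, $H=(1,0)$ that never goes below the $x$-axis. $\mathcal{M}^{lab}_n$ is the set of Motzkin paths of length $n$ in which each horizontal step at height $0$ carries one of the labels $\ell_0,\ell_1$, and each horizontal step at height at least $1$ carries one of the labels $\ell_0,\ell_1,\ell_2$; upsteps and downsteps are regarded as labeled $U$ and $D$. The map $\beta$: given $P\in\mathcal{M}^{lab}_n$, let $\Delta$ be an initially empty stack (last in, first out) and start with $R=1$. Scan the labels of $P$ from left to right and for each label $L$ append a new rightmost element to $R$ as follows. If $L=U$, append a new strict maximum $M$ (one more than the current maximum of $R$) and push $M$ onto $\Delta$. If $L=D$, append the top element of $\Delta$ and pop it from $\Delta$. If $L=\ell_0$, append a new strict maximum (one more than the current maximum), without pushing it onto $\Delta$.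 If $L=\ell_1$, append $1$. If $L=\ell_2$, append the top element of $\Delta$ without popping it. The final sequence $R$, of length $n+1$, is $\beta(P)$. *)

(* Defs.v *)
From mathcomp Require Import all_boot all_order all_algebra.
From mathcomp Require Import classical_sets functions.

Set Implicit Arguments.
Unset Strict Implicit.
Unset Printing Implicit Defensive.

Import Order.TTheory GRing.Theory Num.Theory.

Local Open Scope nat_scope.

Definition max_seq (R : seq nat) : nat := \max_(x <- R) x.

(* Sequences are 1-based in the mathematics and 0-based here: r_1 is
   nth 0 R 0, and the empty sequence is not an RGF. *)
Definition rgf (R : seq nat) : Prop :=
  [/\ all (fun x => 0 < x) R,
      nth 0 R 0 = 1
    & forall i, 0 < i < size R -> nth 0 R i <= 1 + max_seq (take i R)].

Definition std (Q : seq nat) : seq nat :=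
  [seq (index x (sort leq (undup Q))).+1 | x <- Q].

Definition contains (R Q : seq nat) : Prop :=
  exists2 s, subseq s R & std s = Q.

Definition rgf_avoiding (n : nat) (Q : seq nat) : set (seq nat) :=
  [set R | [/\ size R = n, rgf R & ~ contains R Q]]%classic.

Inductive step := StepU | StepD | StepH.

Definition rise (s : step) : int :=
  match s with StepU => 1 | StepD => -1 | StepH => 0 end%R.

Definition height (p : seq step) : int := (\sum_(s <- p) rise s)%R.

Definition motzkin (p : seq step) : Prop :=
  (forall i, i <= size p -> (0 <= height (take i p))%R) /\ height p = 0%R.

Inductive label := U | D | L0 | L1 | L2.

(* The label of a step determines the step, so a labeled path is encoded as
   its word of labels. *)
Definition step_of (l : label) : step :=
  match l with U => StepU | D => StepD | L0 | L1 | L2 => StepH end.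

Definition label_allowed (h : int) (l : label) : bool :=
  match l with L2 => (1 <= h)%R | _ => true end.

Definition labeled_motzkin (n : nat) : set (seq label) :=
  [set P | [/\ size P = n,
      motzkin (map step_of P)
    & forall i, i < size P ->
        label_allowed (height (map step_of (take i P))) (nth U P i)]]%classic.

(* The state is (R, Delta), the top of the stack Delta being its head. The
   default value 0 of head is irrelevant on labeled Motzkin paths, where D
   and L2 are never read with an empty stack. *)
Definition beta_step (st : seq nat * seq nat) (l : label)
    : seq nat * seq nat :=
  let: (R, Delta) := st in
  let M := (max_seq R).+1 in
  match l with
  | U => (rcons R M, M :: Delta)
  | D => (rcons R (head 0 Delta), behead Delta)
  | L0 => (rcons R M, Delta)
  | L1 => (rcons R 1, Delta)
  | L2 => (rcons R (head 0 Delta), Delta)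
  end.

Definition beta (P : seq label) : seq nat :=
  (foldl beta_step ([:: 1], [::]) P).1.

(* Main.v *)
Require Import Defs.
From mathcomp Require Import all_boot all_order all_algebra.
From mathcomp Require Import zify.
From mathcomp Require Import classical_sets functions.

(** The map [beta] appends one entry per label, so it can be inverted by reading
    the sequence once from left to right, provided each entry determines its
    label.  Let [m] be the maximum of the prefix read so far.  An entry [1] comes
    from [L1], and an entry [m.+1] from [U] or [L0].  Any other entry comes from
    [D] or [L2].  What settles the remaining ambiguities is
    [mem_beta_tail]: since the stack is empty at the end and can only be emptied
    by writing its entries out, the old values greater than 1 that still occur
    later are exactly those on the stack.  Hence a new maximum comes from [U] iff
    it occurs again, and an old value comes from [L2] iff it occurs again.  This
    is [decode], which needs no stack; it gives injectivity
    ([decode_beta_tail]).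

    In a restricted growth function the first occurrences of the values appear in
    increasing order and the first entry is 1.  Therefore containing 12323 means
    containing some [b c b c] with [1 < b < c].  Such a pattern exists iff at
    some point an old value [b > 1] is repeated while some larger old value [c]
    still has to occur.  Avoidance is thus the local condition
    [noncrossing_ext]: each repeated value greater than 1 is at least every old
    value that still has to occur ([contains_cons1P]).  The values on the stack
    decrease from top to bottom, because they were pushed when they were the
    maximum; so writing the top of the stack obeys this condition
    ([beta_tail_ext]).  Conversely, given a sequence obeying it, the stack can be
    recovered at each point as the decreasing list of the old values greater
    than 1 that still have to occur ([pending]), and each repeated value greater
    than 1 is its head; so [beta] reproduces the sequence from its decoding
    ([beta_tail_decode]). *)

(** * Reading paths and sequences from left to right *)

(** The entries that the labels [P] append to a prefix with maximum [m], with
    stack [S].  The prefix acts on them through its maximum alone. *)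
Fixpoint beta_tail (m : nat) (S : seq nat) (P : seq label) : seq nat :=
  match P with
  | [::] => [::]
  | U :: P' => m.+1 :: beta_tail m.+1 (m.+1 :: S) P'
  | D :: P' => head 0 S :: beta_tail m (behead S) P'
  | L0 :: P' => m.+1 :: beta_tail m.+1 S P'
  | L1 :: P' => 1 :: beta_tail m S P'
  | L2 :: P' => head 0 S :: beta_tail m S P'
  end.

(** Labeled Motzkin paths starting at height [k] instead of 0.  The height is
    also the size of the stack, so the positivity tests say that [D] and [L2]
    never meet an empty stack. *)
Fixpoint motzkin_from (k : nat) (P : seq label) : bool :=
  match P with
  | [::] => k == 0
  | U :: P' => motzkin_from k.+1 P'
  | D :: P' => (0 < k) && motzkin_from k.-1 P'
  | L2 :: P' => (0 < k) && motzkin_from k P'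
  | _ :: P' => motzkin_from k P'
  end.

Fixpoint decode (m : nat) (T : seq nat) : seq label :=
  if T is x :: T' then
    (if x == 1 then L1
     else if x == m.+1 then (if x \in T' then U else L0)
     else (if x \in T' then L2 else D)) :: decode (maxn m x) T'
  else [::].

(** [rgf_ext] and [noncrossing_ext] state, entry by entry, when a prefix with
    maximum [m] that is a restricted growth function avoiding 12323 remains one
    after appending [T].  The maximum suffices to describe the prefix: the values
    that it contains are 1 to [m], first occurring in increasing order. *)
Fixpoint rgf_ext (m : nat) (T : seq nat) : bool :=
  if T is x :: T' then (0 < x <= m.+1) && rgf_ext (maxn m x) T' else true.

Fixpoint noncrossing_ext (m : nat) (T : seq nat) : bool :=
  if T is x :: T' then
    ((x == 1) || all (fun y => ~~ (x < y <= m)) T')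
      && noncrossing_ext (maxn m x) T'
  else true.

(** The stack that [beta] must have when [T] is still to be written after a
    prefix with maximum [m]. *)
Fixpoint pending (m : nat) (T : seq nat) : seq nat :=
  if m is m'.+1 then
    if (0 < m') && (m \in T) then m :: pending m' T else pending m' T
  else [::].

(** What makes the top of the stack its largest entry: a value is pushed when it
    is a new maximum, so the stack strictly decreases from top to bottom.  The
    initial 1 is never pushed. *)
Definition stack_ok (m : nat) (S : seq nat) : bool :=
  path gtn m.+1 S && all (ltn 1) S.

Lemma stack_ok_push m S : 0 < m -> stack_ok m S -> stack_ok m.+1 (m.+1 :: S).
Proof. by move=> m0; rewrite /stack_ok /= ltnSn ltnS m0. Qed.

Lemma stack_ok_le m m' S : m <= m' -> stack_ok m S -> stack_ok m' S.
Proof.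
case: S => [|d S] //= lemm'; rewrite /stack_ok /= => /andP[/andP[dm ->] ->].
by rewrite (leq_trans dm).
Qed.

Lemma stack_ok_pop m d S :
  stack_ok m (d :: S) -> stack_ok d.-1 S && (1 < d <= m).
Proof.
rewrite /stack_ok /= => /andP[/andP[dm dS] /andP[d1 ->]].
by rewrite d1 -ltnS dm prednK ?dS // ltnW.
Qed.

Lemma stack_ok_bound {m S} : stack_ok m S -> {in S, forall x, 1 < x <= m}.
Proof.
elim: S m => [|d S IH] m //= /stack_ok_pop/and3P[okS d1 dm] x.
rewrite inE => /predU1P[->|/(IH _ okS)]; first by rewrite d1.
by lia.
Qed.

(** * The labels are determined by the output *)

Lemma max_seq_rcons R x : max_seq (rcons R x) = maxn (max_seq R) x.
Proof. by rewrite /max_seq -cats1 big_cat big_seq1. Qed.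

Lemma foldl_beta R S P :
  0 < max_seq R -> stack_ok (max_seq R) S ->
  (foldl beta_step (R, S) P).1 = R ++ beta_tail (max_seq R) S P.
Proof.
elim: P R S => [|l P IH] R S R_gt0 okS; first by rewrite cats0.
have head_le : head 0 S <= max_seq R.
  by case: S okS => [|d S] //= /stack_ok_pop/and3P[].
have maxS : maxn (max_seq R) (max_seq R).+1 = (max_seq R).+1 by lia.
have maxh : maxn (max_seq R) (head 0 S) = max_seq R by lia.
have max1 : maxn (max_seq R) 1 = max_seq R by lia.
case: l => /=; rewrite IH max_seq_rcons ?maxS ?maxh ?max1 ?cat_rcons //.
- exact: stack_ok_push.
- case: S okS {head_le maxh} => [|d S] //= /stack_ok_pop/and3P[okS _ dm].
  by apply: stack_ok_le okS; lia.
- exact: stack_ok_le okS.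
Qed.

(** Every entry of the stack is eventually popped, and [D] writes what it pops;
    old values off the stack have no way to come back, except 1. *)
Lemma mem_beta_tail m S P x : motzkin_from (size S) P -> 1 < x <= m ->
  (x \in beta_tail m S P) = (x \in S).
Proof.
elim: P m S => [|l P IH] m S /=; first by rewrite size_eq0 => /eqP->.
case: l => [okP|/andP[S0 okP]|okP|okP|/andP[S0 okP]] /andP[x1 xm].
- rewrite inE IH //= ?inE; last by rewrite x1 ltnW.
  by case: eqP => // xE; lia.
- by case: S S0 okP => [|d S] //= _ okP; rewrite !inE IH // x1.
- rewrite inE IH //= ?inE; last by rewrite x1 ltnW.
  by case: eqP => // xE; lia.
- by rewrite inE IH ?x1 //; case: eqP => // xE; lia.
- case: S S0 okP => [|d S] //= _ okP; rewrite inE IH ?x1 // inE.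
  by rewrite orbA orbb.
Qed.

(** At each label, [mem_beta_tail] applied to the stack after the step tells
    whether the entry just written recurs: it does iff it is on that stack, and
    since the stack has no repetitions [D] removes it for good. *)
Lemma decode_beta_tail m S P :
  0 < m -> stack_ok m S -> motzkin_from (size S) P ->
  decode m (beta_tail m S P) = P.
Proof.
elim: P m S => [|l P IH] m S m0 okS //=.
have maxS : maxn m m.+1 = m.+1 by lia.
have max1 : maxn m 1 = m by lia.
have m1 : (m.+1 == 1) = false by lia.
case: l => [okP|/andP[S0 okP]|okP|okP|/andP[S0 okP]] /=.
- rewrite m1 eqxx maxS IH //; last exact: stack_ok_push.
  by rewrite mem_beta_tail ?mem_head // ltnSn andbT ltnS.
- case: S S0 okS okP => [|d S] //= _ /stack_ok_pop/and3P[okS d1 dm] okP.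
  have -> : (d == 1) = false by lia.
  have -> : (d == m.+1) = false by lia.
  have -> : maxn m d = m by lia.
  rewrite mem_beta_tail ?d1 // IH //; last by apply: stack_ok_le okS; lia.
  by case: ifP => // /(stack_ok_bound okS); lia.
- rewrite m1 eqxx maxS IH //; last exact: stack_ok_le okS.
  rewrite mem_beta_tail ?ltnS ?m0 //=.
  by case: ifP => // /(stack_ok_bound okS); lia.
- by rewrite max1 IH.
- case: S S0 okS okP => [|d S] //= _ okS okP.
  have /and3P[_ d1 dm] := stack_ok_pop _ _ _ okS.
  have -> : (d == 1) = false by lia.
  have -> : (d == m.+1) = false by lia.
  have -> : maxn m d = m by lia.
  by rewrite mem_beta_tail ?d1 // mem_head IH.
Qed.

(** Larger values that still have to occur would be on the stack, by
    [mem_beta_tail], whereas the value written is the largest of the stack. *)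
Lemma beta_tail_ext m S P :
  0 < m -> stack_ok m S -> motzkin_from (size S) P ->
  rgf_ext m (beta_tail m S P) && noncrossing_ext m (beta_tail m S P).
Proof.
elim: P m S => [|l P IH] m S m0 okS //=.
have maxS : maxn m m.+1 = m.+1 by lia.
have max1 : maxn m 1 = m by lia.
have new T : all (fun y => ~~ (m.+1 < y <= m)) T by apply/allP => y _; lia.
case: l => [okP|/andP[S0 okP]|okP|okP|/andP[S0 okP]] /=.
- rewrite maxS.
  have /andP[-> ->] := IH m.+1 (m.+1 :: S) isT (stack_ok_push _ _ m0 okS) okP.
  by rewrite ltnSn new orbT.
- case: S S0 okS okP => [|d S] //= _ okS okP.
  have /and3P[okS' d1 dm] := stack_ok_pop _ _ _ okS.
  have -> : maxn m d = m by lia.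
  have /andP[-> ->] : rgf_ext m (beta_tail m S P)
      && noncrossing_ext m (beta_tail m S P).
    by apply: IH => //; apply: stack_ok_le okS'; lia.
  have -> : 0 < d <= m.+1 by lia.
  rewrite !andbT; apply/orP; right; apply/allP => y yT; apply/negP => yd.
  move: yT; rewrite mem_beta_tail //; last by lia.
  by move/(stack_ok_bound okS'); lia.
- rewrite maxS.
  have /andP[-> ->] := IH m.+1 S isT (stack_ok_le _ _ _ (leqnSn m) okS) okP.
  by rewrite ltnSn new orbT.
- by rewrite max1; apply: IH.
- case: S S0 okS okP => [|d S] //= _ okS okP.
  have /and3P[okS' d1 dm] := stack_ok_pop _ _ _ okS.
  have -> : maxn m d = m by lia.
  have /andP[-> ->] := IH m (d :: S) m0 okS okP.
  have -> : 0 < d <= m.+1 by lia.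
  rewrite !andbT; apply/orP; right; apply/allP => y yT; apply/negP => yd.
  move: yT; rewrite mem_beta_tail //; last by lia.
  by rewrite inE => /predU1P[|/(stack_ok_bound okS')]; lia.
Qed.

(** * Every non-crossing sequence is an output *)

Lemma pending_cons_out m x T :
  ~~ (1 < x <= m) -> pending m (x :: T) = pending m T.
Proof.
elim: m => //= m IH xm; rewrite inE IH; last by lia.
case: m {IH} xm => //= m xm.
by have -> : (m.+2 == x) = false by lia.
Qed.

Lemma pending_trunc m x T :
  x <= m -> all (fun y => ~~ (x < y <= m)) T -> pending m T = pending x T.
Proof.
elim: m => [|m IH]; first by rewrite leqn0 => /eqP->.
rewrite leq_eqVlt => /predU1P[->//|xm] /allP Tx /=.
have -> : (m.+1 \in T) = false.
  by apply/negP => /Tx; lia.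
rewrite andbF; apply: IH => //.
by apply/allP => y /Tx; lia.
Qed.

(** The stack [pending m T] empties as [T] is written, and non-crossing makes
    any repeated value greater than 1 its head ([pending_trunc]). *)
Lemma beta_tail_decode m T :
  0 < m -> rgf_ext m T -> noncrossing_ext m T ->
  motzkin_from (size (pending m T)) (decode m T)
  && (beta_tail m (pending m T) (decode m T) == T).
Proof.
elim: T m => [|x T IH] m m0 /=.
  by elim: m {m0} => //= m IH; rewrite andbF.
move=> /andP[/andP[x0 xm] Rx] /andP[Tx Nx].
have {IH} := IH (maxn m x) (leq_trans m0 (leq_maxl _ _)) Rx Nx.
have [x1|x1] := eqVneq x 1 => /=.
  have -> : maxn m x = m by lia.
  rewrite pending_cons_out; last by lia.
  by case/andP=> -> /eqP->; rewrite x1 eqxx.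
have [xE|xm1] := eqVneq x m.+1 => /=.
  have -> : maxn m x = m.+1 by lia.
  rewrite pending_cons_out ?xE; last by lia.
  rewrite /= m0 /=; case: (_ \in T) => /= /andP[-> /eqP->]; exact: eqxx.
have -> : maxn m x = m by lia.
rewrite (negPf x1) /= in Tx.
have {xm xm1} xm : x <= m by lia.
case: x x0 x1 xm Tx {Rx Nx} => [|x] // _ x1 xm Tx.
(* The value now written is the top of the stack.  It is also on the stack
   pending afterwards, still at the top, exactly when it recurs: this is where
   decoding chooses between [L2] and [D]. *)
have -> : pending m (x.+1 :: T) = x.+1 :: pending x T.
  rewrite (pending_trunc _ x.+1) //=; last by rewrite ltnn.
  by rewrite mem_head lt0n -eqSS x1 /= pending_cons_out // ltnn andbF.
rewrite (pending_trunc _ x.+1 T) //= lt0n -eqSS x1 /=.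
by case: (_ \in T) => /= /andP[-> /eqP->]; rewrite eqxx.
Qed.

(** * Avoiding 12323 as a local condition *)

(** The part of the pattern [b c b c] not yet matched greedily by a prefix which
    is a restricted growth function with maximum [m], before any crossing is
    under way: [b] is matched as soon as it occurs, and the first [c] as soon as
    it occurs, which is after [b]. *)
Definition rest_bcbc (m b c : nat) : seq nat :=
  if c <= m then [:: b; c] else if b <= m then [:: c; b; c]
  else [:: b; c; b; c].

Lemma rest_bcbc1 b c : 1 < b < c -> rest_bcbc 1 b c = [:: b; c; b; c].
Proof.
case/andP=> b1 bc; rewrite /rest_bcbc [c <= 1]leqNgt [b <= 1]leqNgt.
by rewrite b1 (ltn_trans b1 bc).
Qed.

(** Reading an entry keeps the unmatched part up to date, unless it is the second
    [b], to be followed only by the last [c]: then the crossing is decided by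
    whether [c] still has to occur, which is what [noncrossing_ext] tests. *)
Lemma subseq_rest_bcbc_cons m b c x T :
  1 < b < c -> x <= m.+1 -> ~~ ((x == b) && (c <= m)) ->
  subseq (rest_bcbc m b c) (x :: T) = subseq (rest_bcbc (maxn m x) b c) T.
Proof.
move=> bc xm xbc; rewrite /rest_bcbc.
have [cm|mc] := leqP c m.
  rewrite leq_max cm /=.
  by have -> : (b == x) = false by lia.
have [bm|mb] := leqP b m.
  rewrite !leq_max bm leqNgt mc /=.
  have [->|cx] := eqVneq c x; first by rewrite leqnn.
  by have -> : (c <= x) = false by lia.
have -> : (c <= maxn m x) = false by lia.
rewrite leq_max leqNgt mb /=.
have [->|bx] := eqVneq b x; first by rewrite leqnn.
by have -> : (b <= x) = false by lia.
Qed.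

Lemma noncrossing_extP m T : 0 < m -> rgf_ext m T ->
  reflect (forall b c, 1 < b < c -> ~~ subseq (rest_bcbc m b c) T)
          (noncrossing_ext m T).
Proof.
elim: T m => [|x T IH] m m0.
  move=> _; apply: ReflectT => b c _; rewrite /rest_bcbc.
  by case: ifP => // _; case: ifP.
rewrite [rgf_ext _ _]/= [noncrossing_ext _ _]/= => /andP[/andP[x0 xm] Rx].
have {}IH := IH (maxn m x) (leq_trans m0 (leq_maxl _ _)) Rx.
apply: (iffP andP) => [[Tx /IH {}IH] b c bc|bcT].
  have [/andP[/eqP xb cm]|xbc] := boolP ((x == b) && (c <= m)); last first.
    by rewrite subseq_rest_bcbc_cons // IH.
  move: Tx; have -> : (x == 1) = false by lia.
  rewrite /rest_bcbc cm /= xb eqxx sub1seq => /allP Tb.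
  by apply/negP => /Tb; lia.
split.
  have [//|x1] := eqVneq x 1 => /=.
  (* [x] and [y] are old, and writing [x] now and [y] later would make them the
     [b] and the [c] of a crossing. *)
  apply/allP => y yT; apply/negP => /andP[xy ym].
  have := bcT x y; rewrite /rest_bcbc ym /= eqxx sub1seq yT => /(_ _)/negP.
  by lia.
apply/IH => b c bc.
have [/andP[/eqP xb cm]|xbc] := boolP ((x == b) && (c <= m)); last first.
  by rewrite -subseq_rest_bcbc_cons // bcT.
move: (bcT b c bc); rewrite /rest_bcbc leq_max cm /= xb eqxx.
by apply: contraNN; apply: subseq_trans; apply: subseq_cons.
Qed.

Lemma rgf_extP R T :
  (all (ltn 0) T /\ (forall i, size R <= i < size (R ++ T) ->
     nth 0 (R ++ T) i <= 1 + max_seq (take i (R ++ T))))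
  <-> rgf_ext (max_seq R) T.
Proof.
elim: T R => [|x T IH] R /=.
  by split=> // _; split=> // i; rewrite cats0; lia.
rewrite -max_seq_rcons -cat_rcons; split.
  case=> /andP[x0 T0] H; rewrite x0 /=; apply/andP; split.
    have := H (size R); rewrite cat_rcons nth_cat ltnn subnn take_size_cat //=.
    by rewrite size_cat /= add1n; apply; rewrite leqnn -[ltnLHS]addn0 ltn_add2l.
  apply/IH; split=> // i; rewrite size_rcons => /andP[Ri iT].
  by apply: H; rewrite (ltnW Ri).
move=> /andP[/andP[x0 xm] /IH[T0 H]]; split; first by rewrite x0.
move=> i /andP[]; rewrite leq_eqVlt => /predU1P[<- _|Ri iT].
  by rewrite cat_rcons nth_cat ltnn subnn take_size_cat.
by apply: H; rewrite size_rcons Ri.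
Qed.

Lemma rgf_cons1P T : rgf (1 :: T) <-> rgf_ext 1 T.
Proof.
have -> : rgf_ext 1 T = rgf_ext (max_seq [:: 1]) T by rewrite /max_seq big_seq1.
split=> [[T0 _ H]|/rgf_extP[T0 H]]; first by apply/rgf_extP; split.
by split.
Qed.

Lemma rgf_cons1 R : rgf R -> R = 1 :: behead R.
Proof. by case: R => [|x R] [_ //= ->]. Qed.

(** The letters of [std s] are ranks in the sorted list of values of [s]: equal
    ranks come from equal values and smaller ranks from smaller values. *)
Lemma std12323P s : std s = [:: 1; 2; 3; 2; 3] <->
  exists a b c, [/\ a < b, b < c & s = [:: a; b; c; b; c]].
Proof.
split=> [|[a [b [c [ab bc ->]]]]]; last first.
  rewrite /std; have -> : sort leq (undup [:: a; b; c; b; c]) = [:: a; b; c].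
    apply: (sorted_eq leq_trans anti_leq).
    - exact: sort_sorted leq_total _.
    - by rewrite /= (ltnW ab) (ltnW bc).
    rewrite perm_sort; apply: uniq_perm; first exact: undup_uniq.
      by rewrite /= !inE; lia.
    by move=> x; rewrite mem_undup !inE; do !case: eqP.
  have [ba ca cb] : [/\ (a == b) = false, (a == c) = false & (b == c) = false].
    by split; lia.
  by rewrite /= !eqxx ba ca cb.
have srt : sorted leq (sort leq (undup s)) by apply: sort_sorted leq_total _.
have mem x : x \in s -> x \in sort leq (undup s) by rewrite mem_sort mem_undup.
rewrite /std; move: (sort leq (undup s)) srt mem => u srt.
case: s => [|a [|b [|c [|d [|e [|? ?]]]]]] //= mem.
case=> ia ib ic id ie.
have eqi x y : x \in u -> index x u = index y u -> x = y.
  move=> xu E.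
  have yu : y \in u by rewrite -index_mem -E index_mem.
  by rewrite -(nth_index 0 xu) E nth_index.
have lti x y : x \in u -> y \in u -> index x u < index y u -> x < y.
  move=> xu yu ixy; rewrite ltn_neqAle; apply/andP; split.
    by apply: contraTneq ixy => ->; rewrite ltnn.
  have := sorted_ltn_nth leq_trans 0 srt (index x u) (index y u).
  by rewrite !inE !index_mem !nth_index // => /(_ xu yu ixy).
have [au bu cu] : [/\ a \in u, b \in u & c \in u].
  by split; apply: mem; rewrite !inE eqxx ?orbT.
exists a, b, c; split; [apply: lti => // | apply: lti => // | ].
- by rewrite ia ib.
- by rewrite ib ic.
by rewrite (eqi b d) ?id // (eqi c e) ?ie.
Qed.

(** The initial 1 can always serve as the least letter of the pattern, so only
    [b c b c] matters; as all entries are positive, the other two letters are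
    greater than 1 in any occurrence. *)
Lemma contains_cons1P T : rgf_ext 1 T ->
  ~ contains (1 :: T) [:: 1; 2; 3; 2; 3] <-> noncrossing_ext 1 T.
Proof.
move=> RT; have /rgf_cons1P[pos _ _] := RT.
split=> [nc|/(noncrossing_extP 1 T isT RT) nc].
  apply/(noncrossing_extP 1 T isT RT) => b c bc; apply/negP.
  rewrite rest_bcbc1 //.
  move=> bcT; apply: nc; exists [:: 1; b; c; b; c] => //.
  by apply/std12323P; exists 1, b, c; case/andP: bc.
case=> s sR /std12323P[a [b [c [ab bc sE]]]]; move: sR; rewrite {}sE => sR.
have a0 : 0 < a.
  by move/allP: pos; apply; apply: (mem_subseq sR); apply: mem_head.
have bc1 : 1 < b < c by rewrite bc (leq_ltn_trans a0 ab).
move/negP: (nc b c bc1); rewrite rest_bcbc1 //; apply.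
move: sR; rewrite [subseq _ (1 :: T)]/=; case: eqP => // _ sT.
by apply: subseq_trans sT; apply: subseq_cons.
Qed.

(** * Labeled Motzkin paths *)

Lemma height_cons s p : height (s :: p) = (rise s + height p)%R.
Proof. by rewrite /height big_cons. Qed.

Lemma height_nil : height [::] = 0%R.
Proof. by rewrite /height big_nil. Qed.

Lemma motzkin_fromP (k : nat) P :
  [/\ forall i, i <= size P -> (0 <= k%:Z + height (map step_of (take i P)))%R,
      (k%:Z + height (map step_of P))%R = 0%R
    & forall i, i < size P ->
        label_allowed (k%:Z + height (map step_of (take i P)))%R (nth U P i)]
  <-> motzkin_from k P.
Proof.
elim: P k => [|l P IH] k /=.
  rewrite height_nil; split=> [[_ + _]|/eqP->]; first by lia.
  by split=> // i; rewrite height_nil.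
(* All five labels peel off in the same way, once the height [k'] after the
   step is known to be a natural number. *)
have step (k' : nat) : (k'%:Z = k%:Z + rise (step_of l))%R ->
    [/\ forall i, i <= (size P).+1 ->
      (0 <= k%:Z + height (map step_of (take i (l :: P))))%R,
      (k%:Z + height (step_of l :: map step_of P))%R = 0%R
    & forall i, i < (size P).+1 ->
        label_allowed (k%:Z + height (map step_of (take i (l :: P))))%R
          (nth U (l :: P) i)]
   <-> label_allowed k%:Z l && motzkin_from k' P.
  move=> k'E; split=> [[nn h0 la]|/andP[la0 /IH[nn h0 la]]].
    apply/andP; split.
      by have := la 0 isT; rewrite /= height_nil GRing.addr0.
    apply/IH; split=> [i iP||i iP].
    - by have := nn i.+1 iP; rewrite /= height_cons k'E GRing.addrA.
    - by rewrite k'E -GRing.addrA -height_cons.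
    - by have := la i.+1 iP; rewrite /= height_cons k'E GRing.addrA.
  split=> [[|i] iP||[|i] iP] /=;
    rewrite ?height_nil ?height_cons ?GRing.addr0 //.
  - by rewrite GRing.addrA -k'E; apply: nn.
  - by rewrite GRing.addrA -k'E.
  - by rewrite GRing.addrA -k'E; apply: la.
case: l step => /= step; try (by apply: step; lia).
(* A down step from height 0 is the one case with no natural number [k']. *)
case: k step => [|k] step; last by apply: step; lia.
split=> // [[/(_ 1 isT)]].
by rewrite /= take0 height_cons height_nil.
Qed.

Lemma labeled_motzkinP n P :
  labeled_motzkin n P <-> size P = n /\ motzkin_from 0 P.
Proof.
rewrite /labeled_motzkin /motzkin /= -motzkin_fromP size_map.
split=> [[sP [nn h0] la]|[sP [nn h0 la]]].
  split=> //; split=> [i iP||i iP]; rewrite GRing.add0r ?map_take //; auto.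
    by rewrite -map_take; apply: la.
split=> //; first split=> [i iP|].
- by have := nn i iP; rewrite GRing.add0r map_take.
- by move: h0; rewrite GRing.add0r.
- by move=> i iP; have := la i iP; rewrite GRing.add0r.
Qed.

Lemma betaE P : beta P = 1 :: beta_tail 1 [::] P.
Proof.
by rewrite /beta foldl_beta /max_seq big_seq1.
Qed.

Lemma size_beta_tail m S P : size (beta_tail m S P) = size P.
Proof. by elim: P m S => //= -[] P IH m S /=; rewrite IH. Qed.

Lemma size_decode m T : size (decode m T) = size T.
Proof. by elim: T m => //= x T IH m; rewrite IH. Qed.

(** * The bijection *)

Theorem theorem5p6 (n : nat) :
  set_bij (labeled_motzkin n) (rgf_avoiding n.+1 [:: 1; 2; 3; 2; 3]) beta.
Proof.
split.
- move=> P /labeled_motzkinP[sP okP].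
  have /andP[RT NT] := beta_tail_ext 1 [::] P isT isT okP.
  rewrite /rgf_avoiding /= betaE; split.
  + by rewrite /= size_beta_tail sP.
  + exact/rgf_cons1P.
  + exact/contains_cons1P.
- move=> P Q /set_mem/labeled_motzkinP[_ okP] /set_mem/labeled_motzkinP[_ okQ].
  rewrite !betaE => -[PQ].
  by rewrite -(decode_beta_tail 1 [::] P) // PQ decode_beta_tail.
- move=> R [sR rR aR]; have RE := rgf_cons1 R rR; move: RE sR rR aR.
  move: (behead R) => T -> [sT] /rgf_cons1P RT /(contains_cons1P _ RT) NT.
  have /andP[okP /eqP TE] := beta_tail_decode 1 T isT RT NT.
  exists (decode 1 T); last by rewrite betaE TE.
  by apply/labeled_motzkinP; rewrite size_decode.
Qed.
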